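(* Let $A$ be an $m\times n$ matrix of rank $r$ over a field $\mathrm{K}$, and let $(i_1,j_1),\dots,(i_r,j_r)$ be the sequence of pivot coordinates computed by the Storjohann–Yang algorithm on $A$ (upon success of its randomized choice). Then the $m\times n$ $r$-sub-permutation matrix whose ones are located at positions $(i_s,j_s)$ for $1\le s\le r$ is precisely the rank profile matrix of $A$.
   Context: An $r$-sub-permutation matrix is a matrix of rank $r$ with only $r$ nonzero entries, all equal to one. The rank profile matrix of an $m\times n$ matrix $A$ of rank $r$ is the unique $m\times n$ $r$-sub-permutation matrix each of whose leading sub-matrices (first $i$ rows and first $j$ columns) has the same rank as the corresponding leading sub-matrix of $A$. $A_{\mathcal P,\mathcal Q}$ denotes the sub-matrix of $A$ with rows indexed by $\mathcal P$ and columns indexed by $\mathcal Q$; $*$ denotes all indices. The Storjohann–Yang algorithm: sample a vector $b$ uniformly from the column space of $A$. Incrementally build lists $\mathcal P=[i_1,\dots,i_{s-1}]$ and $\mathcal Q=[j_1,\dots,j_{s-1}]$ with $A_{\mathcal P,\mathcal Q}$ invertible, starting from empty lists. At step $s$ ($s=1,\dots,r$), let $i_s$ be the index of the first nonzero component of $b-A_{*,\mathcal Q}(A_{\mathcal P,\mathcal Q})^{-1}b_{\mathcal P}$; then let $j_s$ be the index of the first nonzero entry of the row vector $A_{i_s,*}-A_{i_s,\mathcal Q}(A_{\mathcal P,\mathcal Q})^{-1}A_{\mathcal P,*}$; append $i_s$ to $\mathcal P$ and $j_s$ to $\mathcal Q$. Success of the randomized choice means that, at every step $s$, $i_s$ is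 the index of the first nonzero row of the Schur complement $A-A_{*,\mathcal Q}(A_{\mathcal P,\mathcal Q})^{-1}A_{\mathcal P,*}$ (i.e. of the first row of $A$ linearly independent from the rows already selected). *)

(* Defs.v *)
From HB Require Import structures.
From mathcomp Require Import all_boot all_order all_algebra.

Set Implicit Arguments.
Unset Strict Implicit.
Unset Printing Implicit Defensive.

Import GRing.Theory.
Local Open Scope ring_scope.

Definition subperm_mx (K : fieldType) (m n : nat) (r : nat)
    (R : 'M[K]_(m, n)) : Prop :=
  [/\ \rank R = r,
      #|[set ij : 'I_m * 'I_n | R ij.1 ij.2 != 0]| = r
    & forall i j, R i j != 0 -> R i j = 1].

Definition leading_mx (K : fieldType) (m n i j : nat)
    (him : (i <= m)%N) (hjn : (j <= n)%N) (A : 'M[K]_(m, n)) : 'M[K]_(i, j) :=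
  mxsub (widen_ord him) (widen_ord hjn) A.

Definition is_rank_profile_mx (K : fieldType) (m n : nat)
    (A R : 'M[K]_(m, n)) : Prop :=
  subperm_mx (\rank A) R /\
  forall (i j : nat) (him : (i <= m)%N) (hjn : (j <= n)%N),
    \rank (leading_mx him hjn R) = \rank (leading_mx him hjn A).

Definition is_first (n : nat) (p : pred 'I_n) (i : 'I_n) : bool :=
  p i && [forall k : 'I_n, (k < i)%N ==> ~~ p k].

Definition first_index (n : nat) (p : pred 'I_n) : option 'I_n :=
  [pick i | is_first p i].

Definition schur_mx (K : fieldType) (m n s : nat) (A : 'M[K]_(m, n))
    (P : s.-tuple 'I_m) (Q : s.-tuple 'I_n) : 'M[K]_(m, n) :=
  A - colsub (tnth Q) A *m invmx (mxsub (tnth P) (tnth Q) A)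
        *m rowsub (tnth P) A.

Definition sy_row (K : fieldType) (m n s : nat) (A : 'M[K]_(m, n))
    (b : 'cV[K]_m) (P : s.-tuple 'I_m) (Q : s.-tuple 'I_n) : option 'I_m :=
  let v := b - colsub (tnth Q) A *m invmx (mxsub (tnth P) (tnth Q) A)
                 *m rowsub (tnth P) b in
  first_index (fun i => v i 0 != 0).

Definition sy_col (K : fieldType) (m n s : nat) (A : 'M[K]_(m, n))
    (P : s.-tuple 'I_m) (Q : s.-tuple 'I_n) (i : 'I_m) : option 'I_n :=
  let v := row i A - row i (colsub (tnth Q) A)
                       *m invmx (mxsub (tnth P) (tnth Q) A)
                       *m rowsub (tnth P) A in
  first_index (fun j => v 0 j != 0).

(* The lists of the first s pivot rows and pivot columns; None when some
   step finds no nonzero component.  invmx M is M itself when M is singular,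
   but the pivoting keeps A_(P, Q) invertible in every successful run. *)
Fixpoint sy_pivots (K : fieldType) (m n : nat) (A : 'M[K]_(m, n))
    (b : 'cV[K]_m) (s : nat) : option (s.-tuple 'I_m * s.-tuple 'I_n) :=
  match s return option (s.-tuple 'I_m * s.-tuple 'I_n) with
  | 0 => Some ([tuple], [tuple])
  | s'.+1 =>
      if sy_pivots A b s' is Some (P, Q) then
        if sy_row A b P Q is Some i then
          if sy_col A P Q i is Some j then
            Some ([tuple of rcons P i], [tuple of rcons Q j])
          else None
        else None
      else None
  end.

(* The random choice enters only through b: success at step s means that the
   first nonzero component of the residual of b is at the first nonzero row
   of the Schur complement. *)
Definition sy_success (K : fieldType) (m n : nat) (A : 'M[K]_(m, n))
    (b : 'cV[K]_m) (r : nat) : Prop :=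
  forall s : nat, (s < r)%N ->
  exists (P : s.-tuple 'I_m) (Q : s.-tuple 'I_n) (i : 'I_m),
    [/\ sy_pivots A b s = Some (P, Q),
        sy_row A b P Q = Some i
      & is_first (fun k => row k (schur_mx A P Q) != 0) i].

Definition pivot_mx (K : fieldType) (m n r : nat)
    (P : r.-tuple 'I_m) (Q : r.-tuple 'I_n) : 'M[K]_(m, n) :=
  \matrix_(i, j) [exists s, (tnth P s == i) && (tnth Q s == j)]%:R.

(* Main.v *)
(* Appending (i, j) to the pivots turns the Schur complement S into
   S - S(*,j) S(i,j)^-1 S(i,*), since both are the unique matrix congruent to A
   modulo the pivot rows and vanishing on the pivot columns.  As S(i,j) is the
   first nonzero entry of its row and of its column, this step lowers by one the
   rank of exactly those leading submatrices that contain (i, j).  Removing the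
   entry (i, j) from the pivot matrix is an elimination step of the same kind, so
   at every step rank A_kl = rank R_kl + rank S_kl for all leading submatrices,
   where R is the pivot matrix.  After r steps R already has rank r, hence
   S = 0.  Uniqueness of the rank profile matrix follows by comparing two of
   them at a position (i, j) of least i + j where they differ. *)
Require Import Defs.
From HB Require Import structures.
From mathcomp Require Import all_boot all_order all_algebra.

Set Implicit Arguments.
Unset Strict Implicit.
Unset Printing Implicit Defensive.

Import GRing.Theory.
Local Open Scope ring_scope.

(** * Elimination of one entry and its effect on ranks *)

Definition elim_mx (K : fieldType) (m n : nat) (i : 'I_m) (j : 'I_n)
    (A : 'M[K]_(m, n)) : 'M[K]_(m, n) :=
  A - (A i j)^-1 *: (col j A *m row i A).

Lemma elim_mxE (K : fieldType) (m n : nat) (i k : 'I_m) (j l : 'I_n)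
    (A : 'M[K]_(m, n)) :
  elim_mx i j A k l = A k l - (A i j)^-1 * (A k j * A i l).
Proof. by rewrite !mxE big_ord1 !mxE. Qed.

(** The row space of [A] is the direct sum of the line of row [i] and the row space of
    [elim_mx i j A]: the latter vanishes in column [j], where row [i] does not. *)
Lemma mxrank_elim (K : fieldType) (m n : nat) (i : 'I_m) (j : 'I_n)
    (A : 'M[K]_(m, n)) :
  A i j != 0 -> \rank A = (1 + \rank (elim_mx i j A))%N.
Proof.
move=> Aij.
have rkAi : \rank (row i A) = 1%N.
  apply/eqP; rewrite eqn_leq rank_leq_row lt0n mxrank_eq0.
  by apply: contraNneq Aij => /rowP/(_ j); rewrite !mxE => ->.
have colA : (elim_mx i j A) *m delta_mx j (0 : 'I_1) = 0.
  rewrite -colE; apply/colP=> k; rewrite mxE elim_mxE mxE mulrCA mulVf //.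
  by rewrite mulr1 subrr.
have AE : (A :=: row i A + elim_mx i j A)%MS.
  apply/eqmxP/andP; split.
    rewrite -[X in (X <= _)%MS](subrK ((A i j)^-1 *: (col j A *m row i A))).
    rewrite -/(elim_mx i j A).
    apply: addmx_sub; first exact: addsmxSr.
    by apply/scalemx_sub/(submx_trans (submxMl _ _))/addsmxSl.
  rewrite addsmx_sub row_sub; apply: addmx_sub => //.
  by rewrite eqmx_opp scalemx_sub // (submx_trans (submxMl _ _)) // row_sub.
rewrite AE mxrank_disjoint_sum ?rkAi //.
apply/eqP/rowV0P => v; rewrite sub_capmx => /andP[/sub_rVP[a ->]].
case/submxP=> D /(congr1 (mulmx^~ (delta_mx j (0 : 'I_1)))).
rewrite -mulmxA colA mulmx0 -colE => /colP/(_ 0); rewrite !mxE => /eqP.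
by rewrite mulf_eq0 (negPf Aij) orbF => /eqP->; rewrite scale0r.
Qed.

(* When the pivot [A i j] is the first nonzero entry of its row and of its
   column, eliminating it alters only the leading submatrices containing it. *)
Lemma mxrank_leading_elim (K : fieldType) (m n k l : nat) (i : 'I_m)
    (j : 'I_n) (him : (k <= m)%N) (hjn : (l <= n)%N) (A : 'M[K]_(m, n)) :
  A i j != 0 -> (forall a : 'I_m, (a < i)%N -> A a j = 0) ->
  (forall b : 'I_n, (b < j)%N -> A i b = 0) ->
  \rank (leading_mx him hjn A) =
    (((i < k) && (j < l)) + \rank (leading_mx him hjn (elim_mx i j A)))%N.
Proof.
move=> Aij colj rowi.
case: (boolP ((i < k) && (j < l))%N) => [/andP[ik jl] | out].
  have wi : widen_ord him (Ordinal ik) = i by apply: val_inj.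
  have wj : widen_ord hjn (Ordinal jl) = j by apply: val_inj.
  rewrite (@mxrank_elim _ _ _ (Ordinal ik) (Ordinal jl)); last first.
    by rewrite mxE wi wj.
  congr (_ + \rank _)%N; apply/matrixP=> a b.
  by rewrite [in RHS]mxE !elim_mxE !mxE wi wj.
congr (\rank _); apply/matrixP=> a b; rewrite [in RHS]mxE elim_mxE mxE.
(* Here [k <= i] or [l <= j], so each entry lies above row [i] or left of column [j], and a factor
   of its correction is zero. *)
case/nandP: out; rewrite -leqNgt => le.
  by rewrite [A (widen_ord _ _) j]colj ?mul0r ?mulr0 ?subr0 //;
    apply: leq_trans (ltn_ord a) le.
by rewrite [A i (widen_ord _ _)]rowi ?mulr0 ?subr0 //;
    apply: leq_trans (ltn_ord b) le.
Qed.

Lemma mxrank_leading_full (K : fieldType) (m n : nat) (A : 'M[K]_(m, n)) :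
  \rank (leading_mx (leqnn m) (leqnn n) A) = \rank A.
Proof.
congr (\rank _); apply/matrixP=> a b; rewrite mxE.
by congr (A _ _); apply: val_inj.
Qed.

(** * Tuples extended by one last element *)

Lemma tnth_rcons_widen (T : Type) (s : nat) (t : s.-tuple T) (x : T)
    (a : 'I_s) :
  tnth [tuple of rcons t x] (widen_ord (leqnSn s) a) = tnth t a.
Proof.
by rewrite !(tnth_nth x) /= nth_rcons size_tuple ltn_ord.
Qed.

Lemma tnth_rcons_max (T : Type) (s : nat) (t : s.-tuple T) (x : T) :
  tnth [tuple of rcons t x] ord_max = x.
Proof. by rewrite (tnth_nth x) /= nth_rcons size_tuple ltnn eqxx. Qed.

Lemma ordS_case (s : nat) (a : 'I_s.+1) :
  (exists b : 'I_s, a = widen_ord (leqnSn s) b) \/ a = ord_max.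
Proof.
have := ltn_ord a; rewrite ltnS leq_eqVlt => /orP[/eqP e | lt].
  by right; apply: val_inj.
by left; exists (Ordinal lt); apply: val_inj.
Qed.


(** * Schur complements along a growing pivot block *)

Lemma colsub_schur_mx (K : fieldType) (m n s : nat) (A : 'M[K]_(m, n))
    (P : s.-tuple 'I_m) (Q : s.-tuple 'I_n) :
  mxsub (tnth P) (tnth Q) A \in unitmx ->
  colsub (tnth Q) (schur_mx A P Q) = 0.
Proof.
move=> U; rewrite /schur_mx linearB /= -mulmx_colsub -mxsubcr.
by rewrite mulmxKV ?subrr.
Qed.

(* The Schur complement is the only matrix congruent to [A] modulo the span
   of the pivot rows that vanishes on the pivot columns. *)
Lemma schur_mx_unique (K : fieldType) (m n s : nat) (A S : 'M[K]_(m, n))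
    (P : s.-tuple 'I_m) (Q : s.-tuple 'I_n) :
  mxsub (tnth P) (tnth Q) A \in unitmx ->
  (A - S <= rowsub (tnth P) A)%MS -> colsub (tnth Q) S = 0 ->
  S = schur_mx A P Q.
Proof.
move=> U /submxP[Z eZ] S0; rewrite /schur_mx.
suff ->: colsub (tnth Q) A = Z *m mxsub (tnth P) (tnth Q) A.
  by rewrite mulmxK // -eZ opprB addrC subrK.
by rewrite [mxsub (tnth _) _ _]mxsubcr mulmx_colsub -eZ linearB /= S0 subr0.
Qed.

Lemma mul_rowsub_rcons (K : fieldType) (m n s : nat) (A : 'M[K]_(m, n))
    (P : s.-tuple 'I_m) (i : 'I_m) (v : 'rV[K]_s.+1) :
  v *m rowsub (tnth [tuple of rcons P i]) A =
    colsub (widen_ord (leqnSn s)) v *m rowsub (tnth P) A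
    + v 0 ord_max *: row i A.
Proof.
apply/rowP=> l; rewrite !mxE big_ord_recr /= !mxE tnth_rcons_max.
by congr (_ + _); apply: eq_bigr => a _; rewrite !mxE tnth_rcons_widen.
Qed.

(** A left kernel vector [(v1, t)] yields a combination of the rows in [P] plus [t] times row [i] of
    the Schur complement. The columns in [Q], where that complement vanishes, kill the first part;
    column [j] then gives [t = 0]. *)
Lemma mxsub_rcons_unit (K : fieldType) (m n s : nat) (A : 'M[K]_(m, n))
    (P : s.-tuple 'I_m) (Q : s.-tuple 'I_n) (i : 'I_m) (j : 'I_n) :
  mxsub (tnth P) (tnth Q) A \in unitmx -> schur_mx A P Q i j != 0 ->
  mxsub (tnth [tuple of rcons P i]) (tnth [tuple of rcons Q j]) A \in unitmx.
Proof.
move=> U Sij; rewrite -row_free_unit; apply: inj_row_free => v.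
rewrite [mxsub (tnth _) _ _]mxsubcr mulmx_colsub mul_rowsub_rcons.
set v1 := colsub _ v; set t := v 0 _ => v0.
pose Z := colsub (tnth Q) A *m invmx (mxsub (tnth P) (tnth Q) A).
have AE : row i A = row i (schur_mx A P Q) + row i Z *m rowsub (tnth P) A.
  by rewrite -row_mul -linearD /= /schur_mx subrK.
have wE : v1 *m rowsub (tnth P) A + t *: row i A =
    (v1 + t *: row i Z) *m rowsub (tnth P) A + t *: row i (schur_mx A P Q).
  by rewrite AE scalerDr mulmxDl -scalemxAl addrA addrAC.
move: v0; rewrite {}wE => v0.
have u0 : v1 + t *: row i Z = 0.
  suff: (v1 + t *: row i Z) *m mxsub (tnth P) (tnth Q) A = 0.
    move/(congr1 (mulmx^~ (invmx (mxsub (tnth P) (tnth Q) A)))).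
    by rewrite mulmxK // mul0mx.
  apply/rowP=> l; have /rowP/(_ (widen_ord (leqnSn s) l)) := v0.
  have /matrixP/(_ i l) := colsub_schur_mx U.
  rewrite !mxE tnth_rcons_widen => ->.
  rewrite mulr0 addr0 => e; rewrite -[RHS]e.
  by apply: eq_bigr => c _; rewrite !mxE.
have t0 : t = 0.
  have /rowP/(_ ord_max) := v0.
  rewrite u0 mul0mx add0r [RHS]mxE 2!mxE [row _ _ _ _]mxE tnth_rcons_max.
  by move/eqP; rewrite mulf_eq0 (negPf Sij) orbF => /eqP.
move: u0; rewrite t0 scale0r addr0 => v10.
apply/rowP=> a; rewrite mxE; case: (ordS_case a) => [[b ->]|->].
  by have /rowP/(_ b) := v10; rewrite !mxE.
exact: t0.
Qed.

Lemma schur_mx_rcons (K : fieldType) (m n s : nat) (A : 'M[K]_(m, n))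
    (P : s.-tuple 'I_m) (Q : s.-tuple 'I_n) (i : 'I_m) (j : 'I_n) :
  mxsub (tnth P) (tnth Q) A \in unitmx -> schur_mx A P Q i j != 0 ->
  schur_mx A [tuple of rcons P i] [tuple of rcons Q j] =
    elim_mx i j (schur_mx A P Q).
Proof.
move=> U Sij; set S := schur_mx A P Q.
have AS : (A - S <= rowsub (tnth P) A)%MS.
  by rewrite /S /schur_mx opprB addrC subrK submxMl.
have PS : (rowsub (tnth P) A <= rowsub (tnth [tuple of rcons P i]) A)%MS.
  apply: (submx_rowsub (widen_ord (leqnSn s))) => a /=.
  by rewrite tnth_rcons_widen.
have iS : (row i A <= rowsub (tnth [tuple of rcons P i]) A)%MS.
  rewrite rowEsub; apply: (submx_rowsub (fun=> ord_max)) => a /=.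
  by rewrite tnth_rcons_max.
apply/esym/schur_mx_unique; first exact: mxsub_rcons_unit.
  (* Row [i] of [S] is row [i] of [A] modulo the rows in [P], so the correction stays in the span of
     the extended pivot rows. *)
  rewrite /elim_mx opprB addrCA; apply: addmx_sub.
    apply/scalemx_sub/(submx_trans (submxMl _ _)).
    rewrite -[S](subKr A) linearB /=; apply: addmx_sub => //.
    rewrite eqmx_opp; apply: submx_trans (row_sub _ _) _.
    exact: submx_trans AS PS.
  exact: submx_trans AS PS.
apply/matrixP=> a l; rewrite mxE elim_mxE [RHS]mxE.
case: (ordS_case l) => [[b ->]|->].
  rewrite tnth_rcons_widen; have Sb k : S k (tnth Q b) = 0.
    by have /matrixP/(_ k b) := colsub_schur_mx U; rewrite mxE [RHS]mxE.
  by rewrite !Sb !mulr0 subr0.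
by rewrite tnth_rcons_max mulrCA mulVf // mulr1 subrr.
Qed.

(** A repeated index would give the block two equal rows or two equal columns, hence determinant
    zero. *)
Lemma mxsub_unit_uniq (K : fieldType) (m n s : nat) (A : 'M[K]_(m, n))
    (P : s.-tuple 'I_m) (Q : s.-tuple 'I_n) :
  mxsub (tnth P) (tnth Q) A \in unitmx -> uniq P /\ uniq Q.
Proof.
rewrite unitmxE unitfE => U; split; apply/tuple_uniqP => a b eab.
  apply: contraNeq U => ne; apply/eqP/(determinant_alternate ne) => c.
  by rewrite !mxE eab.
rewrite -det_tr in U; apply: contraNeq U => ne.
by apply/eqP/(determinant_alternate ne) => c; rewrite !mxE eab.
Qed.

(** * The pivot matrix as pivots are appended *)

Lemma pivot_mx_neq0 (K : fieldType) (m n s : nat)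
    (P : s.-tuple 'I_m) (Q : s.-tuple 'I_n) (i : 'I_m) (j : 'I_n) :
  pivot_mx K P Q i j != 0 -> i \in P /\ j \in Q.
Proof.
rewrite mxE; case: existsP => [[a /andP[/eqP<- /eqP<-]] _|_].
  by rewrite !mem_tnth.
by rewrite eqxx.
Qed.

Lemma pivot_mx_rcons (K : fieldType) (m n s : nat)
    (P : s.-tuple 'I_m) (Q : s.-tuple 'I_n) (i k : 'I_m) (j l : 'I_n) :
  i \notin P ->
  pivot_mx K [tuple of rcons P i] [tuple of rcons Q j] k l =
    pivot_mx K P Q k l + ((k == i) && (l == j))%:R.
Proof.
move=> iP; rewrite !mxE.
case: (boolP [exists a, (tnth P a == k) && (tnth Q a == l)]) => [|noPQ].
  case/existsP=> a ea; have ->: (k == i) = false.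
    by apply: contraNF iP => /eqP<-; case/andP: ea => /eqP<- _; exact: mem_tnth.
  rewrite addr0; congr (_%:R); apply/eqP; rewrite eqb1; apply/existsP.
  by exists (widen_ord (leqnSn s) a); rewrite !tnth_rcons_widen.
rewrite add0r; congr (nat_of_bool _)%:R; apply/existsP/andP.
  case=> a; case: (ordS_case a) => [[b ->]|->];
    rewrite ?tnth_rcons_widen ?tnth_rcons_max.
    by move=> e; case/existsP: noPQ; exists b.
  by rewrite ![_ == i]eq_sym ![_ == j]eq_sym => /andP.
by case=> /eqP-> /eqP->; exists ord_max; rewrite !tnth_rcons_max !eqxx.
Qed.

(** Row [i] and column [j] of the old pivot matrix are zero, so the new one stands alone in its row
    and column, and eliminating it restores the old matrix. *)
Lemma mxrank_leading_pivot_rcons (K : fieldType) (m n s k l : nat)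
    (him : (k <= m)%N) (hjn : (l <= n)%N)
    (P : s.-tuple 'I_m) (Q : s.-tuple 'I_n) (i : 'I_m) (j : 'I_n) :
  i \notin P -> j \notin Q ->
  \rank (leading_mx him hjn
      (pivot_mx K [tuple of rcons P i] [tuple of rcons Q j])) =
    (((i < k) && (j < l)) + \rank (leading_mx him hjn (pivot_mx K P Q)))%N.
Proof.
move=> iP jQ.
have Ri b : pivot_mx K P Q i b = 0.
  by apply/eqP; apply: contraNT iP => /pivot_mx_neq0[].
have Rj a : pivot_mx K P Q a j = 0.
  by apply/eqP; apply: contraNT jQ => /pivot_mx_neq0[].
rewrite (@mxrank_leading_elim _ _ _ _ _ i j).
- congr (_ + \rank (leading_mx _ _ _))%N; apply/matrixP=> a b.
  rewrite elim_mxE !pivot_mx_rcons // !Ri !Rj !eqxx !add0r !andbT andTb invr1 mul1r.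
  by rewrite -natrM mulnb addrK.
- by rewrite pivot_mx_rcons // Ri !eqxx add0r oner_eq0.
- move=> a ai; rewrite pivot_mx_rcons // Rj add0r -val_eqE.
  by rewrite (ltn_eqF ai).
- move=> b bj; rewrite pivot_mx_rcons // Ri add0r -!val_eqE.
  by rewrite [val b == _](ltn_eqF bj) andbF.
Qed.

(** * The rank identity maintained by the algorithm *)

Lemma schur_mx0 (K : fieldType) (m n : nat) (A : 'M[K]_(m, n)) :
  schur_mx A [tuple] [tuple] = A.
Proof. by apply/matrixP=> a b; rewrite !mxE big_ord0 subr0. Qed.

Lemma sy_colE (K : fieldType) (m n s : nat) (A : 'M[K]_(m, n))
    (P : s.-tuple 'I_m) (Q : s.-tuple 'I_n) (i : 'I_m) :
  sy_col A P Q i = first_index (fun j => schur_mx A P Q i j != 0).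
Proof.
rewrite /sy_col /first_index; apply: eq_pick => j.
have E l : (row i A - row i (colsub (tnth Q) A)
    *m invmx (mxsub (tnth P) (tnth Q) A) *m rowsub (tnth P) A) 0 l
    = schur_mx A P Q i l.
  by rewrite -!row_mul -linearB /= mxE.
by rewrite /is_first E; congr (_ && _); apply: eq_forallb => l; rewrite E.
Qed.

Lemma is_first_min (n : nat) (p : pred 'I_n) (i k : 'I_n) :
  is_first p i -> (k < i)%N -> ~~ p k.
Proof. by case/andP=> _ /forallP/(_ k)/implyP. Qed.

(** Invertibility is carried through the induction together with the rank identity, since it makes
    [invmx] a true inverse and lets the next Schur complement be an elimination of the current
    one. *)
Lemma sy_pivots_rank (K : fieldType) (m n r : nat) (A : 'M[K]_(m, n))
    (b : 'cV[K]_m) (success : sy_success A b r)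
    (s : nat) (P : s.-tuple 'I_m) (Q : s.-tuple 'I_n) :
  (s <= r)%N -> sy_pivots A b s = Some (P, Q) ->
  mxsub (tnth P) (tnth Q) A \in unitmx /\
  forall (k l : nat) (him : (k <= m)%N) (hjn : (l <= n)%N),
    \rank (leading_mx him hjn A) =
      (\rank (leading_mx him hjn (pivot_mx K P Q)) +
       \rank (leading_mx him hjn (schur_mx A P Q)))%N.
Proof.
elim: s P Q => [|s IHs] P Q.
  move=> _ _; rewrite (tuple0 P) (tuple0 Q); split.
    by rewrite unitmxE det_mx00 unitr1.
  move=> k l him hjn; rewrite schur_mx0.
  suff ->: leading_mx him hjn (pivot_mx K [tuple] [tuple]) = 0.
    by rewrite mxrank0.
  apply/matrixP=> c d; rewrite !mxE; case: existsP => // -[[]] //.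
move=> sr; case: (success s sr) => P0 [Q0] [i] [eP ei fi].
rewrite /= eP ei; case ej: (sy_col A P0 Q0 i) => [j|] // [<- <-].
have [U rk] := IHs _ _ (ltnW sr) eP.
move: ej; rewrite sy_colE /first_index; case: pickP => // j' fj [ej].
move: fj; rewrite {j'}ej => fj.
set S := schur_mx A P0 Q0 in rk fi fj *.
have Sij : S i j != 0 by case/andP: fj.
have U' := mxsub_rcons_unit U Sij; split => // k l him hjn.
have [] := mxsub_unit_uniq U'; rewrite !rcons_uniq => /andP[iP _] /andP[jQ _].
rewrite rk schur_mx_rcons // mxrank_leading_pivot_rcons //.
rewrite (@mxrank_leading_elim _ _ _ _ _ i j _ _ S) //.
- by rewrite addnCA addnA.
(* Success makes every row of [S] above row [i] zero, so the pivot is also the first nonzero entry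
   of its column. *)
- move=> a /(is_first_min fi); rewrite negbK => /eqP/rowP/(_ j).
  by rewrite !mxE.
- by move=> c /(is_first_min fj); rewrite negbK => /eqP.
Qed.

(** * Uniqueness of the rank profile matrix *)

(** The nonzero rows alone span the row space. *)
Lemma mxrank_le_nz_rows (K : fieldType) (m n : nat) (R : 'M[K]_(m, n)) :
  (\rank R <= #|[set ij.1 | ij in [set ij : 'I_m * 'I_n | R ij.1 ij.2 != 0%R]]|)%N.
Proof.
set I := [set _ | _ in _].
have: (R <= rowsub (fun a : 'I_#|I| => enum_val a) R)%MS.
  apply/row_subP=> i; case: (boolP (i \in I)) => [iI | niI].
    rewrite -(enum_rankK_in iI iI).
    by rewrite -(row_rowsub (fun a : 'I_#|I| => enum_val a)) row_sub.
  rewrite (_ : row i R = 0) ?sub0mx //; apply/rowP=> j; rewrite !mxE.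
  apply/eqP; apply: contraNT niI => Rij.
  by apply/imsetP; exists (i, j); rewrite ?inE.
by move/mxrankS/leq_trans; apply; apply: rank_leq_row.
Qed.

(** The rank is at most the number of nonzero rows, itself at most the number of nonzero entries;
    equality of the two ends leaves a single nonzero entry in each nonzero row. *)
Lemma rank_card_row_inj (K : fieldType) (m n : nat) (R : 'M[K]_(m, n)) :
  \rank R = #|[set ij : 'I_m * 'I_n | R ij.1 ij.2 != 0]| ->
  forall i j l, R i j != 0 -> R i l != 0 -> j = l.
Proof.
move=> rkR i j l Rij Ril.
have: {in [set ij : 'I_m * 'I_n | R ij.1 ij.2 != 0] &, injective fst}.
  apply/imset_injP; rewrite eqn_leq leq_imset_card -rkR.
  exact: mxrank_le_nz_rows.
by move/(_ (i, j) (i, l)); rewrite !inE => /(_ Rij Ril erefl) [].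
Qed.

Lemma rank_card_col_inj (K : fieldType) (m n : nat) (R : 'M[K]_(m, n)) :
  \rank R = #|[set ij : 'I_m * 'I_n | R ij.1 ij.2 != 0]| ->
  forall i k j, R i j != 0 -> R k j != 0 -> i = k.
Proof.
move=> rkR i k j Rij Rkj.
apply: (@rank_card_row_inj _ _ _ R^T _ j); rewrite ?mxE //.
have swapI : injective (fun ij : 'I_m * 'I_n => (ij.2, ij.1)).
  by move=> [a b] [c d] [-> ->].
rewrite mxrank_tr rkR -(card_imset _ swapI); apply: eq_card => -[b a].
rewrite !inE mxE; apply/imsetP/idP => [[[c d]]|Rab].
  by rewrite inE /= => ? [-> ->].
by exists (a, b); rewrite ?inE.
Qed.

(** If [R2 i j] were zero, the leading block of [R2] ending at [(i, j)] would be that of [R1] with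
    its entry [(i, j)] eliminated, hence of rank one less. *)
Lemma rank_profile_step (K : fieldType) (m n r : nat) (R1 R2 : 'M[K]_(m, n))
    (i : 'I_m) (j : 'I_n) :
  subperm_mx r R1 ->
  (forall (k l : nat) (him : (k <= m)%N) (hjn : (l <= n)%N),
    \rank (leading_mx him hjn R1) = \rank (leading_mx him hjn R2)) ->
  (forall (k : 'I_m) (l : 'I_n),
    (k <= i)%N -> (l <= j)%N -> (k + l < i + j)%N -> R1 k l = R2 k l) ->
  R1 i j != 0 -> R2 i j != 0.
Proof.
case=> rk1 card1 _ rkE agree Rij; apply/negP => /eqP R2ij.
have inj := rank_card_row_inj (etrans rk1 (esym card1)).
have injc := rank_card_col_inj (etrans rk1 (esym card1)).
have rowi l : l != j -> R1 i l = 0.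
  by apply: contraNeq => Ril; apply/eqP/(inj i).
have colj k : k != i -> R1 k j = 0.
  by apply: contraNeq => Rkj; apply/eqP/(injc _ _ j).
have := rkE _ _ (ltn_ord i) (ltn_ord j).
rewrite (@mxrank_leading_elim _ _ _ _ _ i j) //; first last.
- by move=> l lj; rewrite rowi // -val_eqE ltn_eqF.
- by move=> k ki; rewrite colj // -val_eqE ltn_eqF.
rewrite !ltnSn (_ : leading_mx _ _ (elim_mx i j R1) =
                    leading_mx (ltn_ord i) (ltn_ord j) R2).
  by move/eqP; rewrite -[X in _ == X]add0n eqn_add2r.
apply/matrixP=> a c; rewrite !mxE big_ord1 !mxE.
set k := widen_ord _ a; set l := widen_ord _ c.
have ki : (k <= i)%N by have := ltn_ord a; rewrite ltnS.
have lj : (l <= j)%N by have := ltn_ord c; rewrite ltnS.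
(* Off the pivot the correction vanishes, as [R1] is zero elsewhere in row [i] and column [j], and
   the smaller index sum gives [R1 k l = R2 k l]. *)
have [ek | nk] := eqVneq k i; have [el | nl] := eqVneq l j.
- by rewrite ek el mulKf // subrr R2ij.
- rewrite ek (rowi _ nl) !mulr0 subr0 -(rowi _ nl) agree //.
  by rewrite ltn_add2l ltn_neqAle lj andbT; exact: nl.
- rewrite el (colj _ nk) mul0r mulr0 subr0 -(colj _ nk) agree //.
  by rewrite ltn_add2r ltn_neqAle ki andbT; exact: nk.
- rewrite (rowi _ nl) !mulr0 subr0 agree //.
  by rewrite -addSn leq_add // ltn_neqAle ki andbT; exact: nk.
Qed.

Lemma rank_profile_mx_inj (K : fieldType) (m n : nat) (A R1 R2 : 'M[K]_(m, n)) :
  is_rank_profile_mx A R1 -> is_rank_profile_mx A R2 -> R1 = R2.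
Proof.
move=> [S1 rk1] [S2 rk2].
suff eqR N : forall (i : 'I_m) (j : 'I_n), (i + j < N)%N -> R1 i j = R2 i j.
  by apply/matrixP=> i j; apply: (eqR (i + j).+1).
elim: N => // N IHN i j; rewrite ltnS => ijN.
have agree (k : 'I_m) (l : 'I_n) :
    (k <= i)%N -> (l <= j)%N -> (k + l < i + j)%N -> R1 k l = R2 k l.
  by move=> _ _ lt; apply: IHN; apply: leq_trans lt ijN.
have imp12 : R1 i j != 0 -> R2 i j != 0.
  by apply: (rank_profile_step S1) => // *; rewrite rk1 rk2.
have imp21 : R2 i j != 0 -> R1 i j != 0.
  apply: (rank_profile_step S2) => [*|*]; first by rewrite rk1 rk2.
  by rewrite agree.
case: S1 S2 => _ _ one1 [_ _ one2].
have [R1ij|R1ij] := eqVneq (R1 i j) 0; last first.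
  by rewrite (one1 _ _ R1ij) (one2 _ _ (imp12 R1ij)).
have [R2ij|R2ij] := eqVneq (R2 i j) 0; first by rewrite R1ij R2ij.
by case/eqP: (imp21 R2ij).
Qed.

(** * From the rank identity to the rank profile matrix *)

Theorem theorem32 (K : fieldType) (m n r : nat) (A : 'M[K]_(m, n))
    (b : 'cV[K]_m) (P : r.-tuple 'I_m) (Q : r.-tuple 'I_n)
    (rkA : \rank A = r)
    (bA : exists x : 'cV[K]_n, b = A *m x)
    (success : sy_success A b r)
    (pivots : sy_pivots A b r = Some (P, Q)) :
  unique (is_rank_profile_mx A) (pivot_mx K P Q).
Proof.
have [U rk] := sy_pivots_rank success (leqnn r) pivots.
have [/tuple_uniqP Pinj /tuple_uniqP Qinj] := mxsub_unit_uniq U.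
(* The identity block at the pivots bounds the rank of the pivot matrix below by [r]. *)
have subR : mxsub (tnth P) (tnth Q) (pivot_mx K P Q) = 1%:M.
  apply/matrixP=> a c; rewrite !mxE; congr (nat_of_bool _)%:R.
  apply/existsP/eqP => [[d /andP[/eqP/Pinj <- /eqP/Qinj <-]] // | ->].
  by exists c; rewrite !eqxx.
have rkR : (r <= \rank (pivot_mx K P Q))%N.
  rewrite -[X in (X <= _)%N](mxrank1 K) -subR mxsubcr.
  rewrite -(mulmx1 (rowsub _ _)) -mulmx_colsub (leq_trans (mxrankM_maxl _ _)) //.
  exact/mxrankS/rowsub_sub.
(* At full size the rank identity splits [r] between the pivot matrix and the Schur complement, so
   the lower bound leaves rank zero for the latter. *)
have := rk _ _ (leqnn m) (leqnn n); rewrite !mxrank_leading_full rkA => rE.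
have eqR : \rank (pivot_mx K P Q) = r.
  by apply/eqP; rewrite eqn_leq rkR andbT [X in (_ <= X)%N]rE leq_addr.
have S0 : schur_mx A P Q = 0.
  apply/eqP; rewrite -mxrank_eq0 -(eqn_add2l (\rank (pivot_mx K P Q))).
  by rewrite -rE addn0 eqR.
suff prof : is_rank_profile_mx A (pivot_mx K P Q).
  by split=> // R; apply: rank_profile_mx_inj.
split; last first.
  move=> k l him hjn.
  rewrite rk S0 (_ : leading_mx _ _ 0 = 0) ?mxrank0 ?addn0 //.
  by apply/matrixP=> a c; rewrite !mxE.
rewrite rkA; split=> // [|i j]; last first.
  by rewrite mxE; case: existsP => // _; rewrite eqxx.
(* The nonzero positions are the injective image of the [r] step indices. *)
have PQinj : injective (fun a => (tnth P a, tnth Q a)) by move=> a c [/Pinj].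
rewrite -[RHS]card_ord -cardsT -(card_imset _ PQinj); apply: eq_card => -[i j].
rewrite inE mxE; apply/idP/imsetP => /= [|[a _ [-> ->]]]; last first.
  by case: existsP => [_|[]]; [apply: oner_neq0 | exists a; rewrite !eqxx].
case: existsP => [[a /andP[/eqP <- /eqP <-]] _|_]; last by rewrite eqxx.
by exists a; rewrite ?inE.
Qed.
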